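(* Let $p=2$, $X=(X_1,X_2)\in\mathbb{R}^{n\times 2}$ with $\|X_1\|_2=\|X_2\|_2=1$ and $X_1^TX_2=-\hat\rho$, where $0<\hat\rho<1$, and put $\hat\varphi^2:=1-\hat\rho$. Let $\beta_1^0\ge\beta_2^0>0$ and $\lambda>0$, and let $\beta^*$ be the noiseless Lasso (see context). Consider the cases Case 1: $\lambda/\hat\varphi^2\le\beta_2^0$; Case 2: $\beta_2^0\le\lambda/\hat\varphi^2\le\beta_2^0+(\beta_1^0-\beta_2^0)/\hat\varphi^2$; Case 3: $\lambda/\hat\varphi^2\ge\beta_2^0+(\beta_1^0-\beta_2^0)/\hat\varphi^2$. Then $$\|X(\beta^*-\beta^0)\|_2^2=\begin{cases}2\lambda^2/\hat\varphi^2&\text{in Case 1}\\ \hat\varphi^2(2-\hat\varphi^2)(\beta_2^0)^2+\lambda^2&\text{in Case 2}\\ \|X\beta^0\|_2^2&\text{in Case 3}\end{cases}$$ and $$\beta^*=\begin{cases}\begin{pmatrix}\beta_1^0-\lambda/\hat\varphi^2\\ \beta_2^0-\lambda/\hat\varphi^2\end{pmatrix}&\text{in Case 1}\\[2ex] \begin{pmatrix}\beta_1^0-(1-\hat\varphi^2)\beta_2^0-\lambda\\ 0\end{pmatrix}&\text{in Case 2}\\[2ex] \begin{pmatrix}0\\0\end{pmatrix}&\text{in Case 3.}\end{cases}$$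
   Context: The noiseless Lasso is $\beta^*:=\arg\min_{\beta\in\mathbb{R}^2}\{\|X(\beta-\beta^0)\|_2^2+2\lambda\|\beta\|_1\}$, where $\beta^0=(\beta_1^0,\beta_2^0)^T$. *)

(* Defs.v *)
From mathcomp Require Import all_boot all_order all_algebra.
From mathcomp Require Import reals.
Set Implicit Arguments.
Unset Strict Implicit.
Unset Printing Implicit Defensive.
Import Order.TTheory GRing.Theory Num.Theory.
Local Open Scope ring_scope.

Definition l1norm (R : realType) (n : nat) (v : 'cV[R]_n) : R :=
  \sum_(i < n) `|v i 0|.

Definition l2norm (R : realType) (n : nat) (v : 'cV[R]_n) : R :=
  Num.sqrt (\sum_(i < n) v i 0 ^+ 2).

Definition col2 (R : realType) (a b : R) : 'cV[R]_2 :=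
  \col_(i < 2) (if i == 0 then a else b).

Definition lasso_objective (R : realType) (n p : nat) (X : 'M[R]_(n, p))
    (beta0 : 'cV[R]_p) (lambda : R) (beta : 'cV[R]_p) : R :=
  l2norm (X *m (beta - beta0)) ^+ 2 + 2 * lambda * l1norm beta.

Definition is_noiseless_lasso (R : realType) (n p : nat) (X : 'M[R]_(n, p))
    (beta0 : 'cV[R]_p) (lambda : R) (beta_star : 'cV[R]_p) : Prop :=
  forall beta : 'cV[R]_p,
    lasso_objective X beta0 lambda beta_star <= lasso_objective X beta0 lambda beta.

(* Main.v *)
(* By convexity a KKT point beats every competitor beta by at least
   ||X (beta - beta_star)||^2, so when X is injective the KKT point is the
   unique minimizer; the Gram matrix [[1, -rho], [-rho, 1]] is invertible
   because rho < 1.  It remains to exhibit the KKT point of each case: its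
   subgradient is (1, 1) in Case 1, (1, z) in Case 2 and (z, z') in Case 3. *)
Require Import Defs.
From mathcomp Require Import all_boot all_order all_algebra.
From mathcomp Require Import reals.
From mathcomp Require Import ring lra.
Import Order.TTheory GRing.Theory Num.Theory.
Local Open Scope ring_scope.

Set Implicit Arguments.
Unset Strict Implicit.

Lemma l2norm_sqrE (R : realType) (n : nat) (v : 'cV[R]_n) :
  l2norm v ^+ 2 = (v^T *m v) 0 0.
Proof.
rewrite /l2norm sqr_sqrtr ?sumr_ge0// => [|i _]; last exact: sqr_ge0.
by rewrite mxE; apply: eq_bigr => i _; rewrite mxE expr2.
Qed.

Lemma l2norm_sqr_le0 (R : realType) (n : nat) (v : 'cV[R]_n) :
  l2norm v ^+ 2 <= 0 -> v = 0.
Proof.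
rewrite l2norm_sqrE mxE => v_le0.
have v2_ge0 (i : 'I_n) : true -> 0 <= v^T 0 i * v i 0.
  by rewrite mxE -expr2 sqr_ge0.
have v_eq0 : \sum_i v^T 0 i * v i 0 == 0 by rewrite eq_le v_le0 sumr_ge0.
move: v_eq0; rewrite psumr_eq0// => /allP v_eq0.
apply/colP => i; rewrite [RHS]mxE.
have := v_eq0 i (mem_index_enum i); rewrite /= mxE mulf_eq0 orbb.
by move/eqP.
Qed.

Lemma l2norm_sqrD (R : realType) (n : nat) (u v : 'cV[R]_n) :
  l2norm (u + v) ^+ 2
  = l2norm u ^+ 2 + 2 * (u^T *m v) 0 0 + l2norm v ^+ 2.
Proof.
rewrite !l2norm_sqrE !mxE mulr_sumr -!big_split; apply: eq_bigr => i _.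
by rewrite !mxE /=; ring.
Qed.

(** [z] is a subgradient of the l1 norm at [beta]: the equation [z i 0 * beta i 0 = |beta i 0|]
    forces the sign where [beta i 0] is nonzero and is void where it vanishes. The stationarity
    equation is divided by 2. *)
Definition lasso_kkt (R : realType) (n p : nat) (X : 'M[R]_(n, p))
    (beta0 : 'cV[R]_p) (lambda : R) (beta z : 'cV[R]_p) : Prop :=
  [/\ X^T *m X *m (beta - beta0) = - lambda *: z,
      forall i, `|z i 0| <= 1 & forall i, z i 0 * beta i 0 = `|beta i 0|].

(** Expanding the square around [beta_star] is exact. Stationarity turns the cross term into
    [- 2 * lambda] times the pairing of [z] with [beta], less the l1 norm of [beta_star]; that
    pairing is at most the l1 norm of [beta]. *)
Lemma lasso_kkt_gap (R : realType) (n p : nat) (X : 'M[R]_(n, p))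
    (beta0 : 'cV[R]_p) (lambda : R) (beta_star z beta : 'cV[R]_p) :
  0 <= lambda -> lasso_kkt X beta0 lambda beta_star z ->
  lasso_objective X beta0 lambda beta_star + l2norm (X *m (beta - beta_star)) ^+ 2
  <= lasso_objective X beta0 lambda beta.
Proof.
move=> lambda_ge0 [stat z_le1 z_sign]; rewrite /lasso_objective.
have -> : beta - beta0 = (beta - beta_star) + (beta_star - beta0).
  by rewrite addrA subrK.
rewrite [in leRHS]mulmxDr l2norm_sqrD trmx_mul -mulmxA [X^T *m _]mulmxA stat.
have -> : ((beta - beta_star)^T *m (- lambda *: z)) 0 0
    = - lambda * (\sum_i z i 0 * beta i 0 - l1norm beta_star).
  rewrite mxE /l1norm -sumrB mulr_sumr; apply: eq_bigr => i _.
  by rewrite !mxE -z_sign; ring.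
have z_le : \sum_i z i 0 * beta i 0 <= l1norm beta.
  apply: ler_sum => i _; apply: le_trans (ler_norm _) _.
  by rewrite normrM ler_piMl.
by nra.
Qed.

Lemma lasso_kkt_unique (R : realType) (n p : nat) (X : 'M[R]_(n, p))
    (beta0 : 'cV[R]_p) (lambda : R) (beta_star z : 'cV[R]_p) :
  (forall h : 'cV[R]_p, X *m h = 0 -> h = 0) ->
  0 <= lambda -> lasso_kkt X beta0 lambda beta_star z ->
  unique (is_noiseless_lasso X beta0 lambda) beta_star.
Proof.
move=> X_inj lambda_ge0 kkt; split=> [beta|beta beta_min].
  apply: le_trans (lasso_kkt_gap beta lambda_ge0 kkt).
  by rewrite lerDl sqr_ge0.
have gap := lasso_kkt_gap beta lambda_ge0 kkt.
have le_star := beta_min beta_star.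
apply/esym/eqP; rewrite -subr_eq0; apply/eqP/X_inj/l2norm_sqr_le0.
by lra.
Qed.

Lemma col2_eta (R : realType) (v : 'cV[R]_2) : v = col2 (v 0 0) (v 1 0).
Proof.
apply/colP => i; rewrite mxE.
by case: i => [[|[|//]]] lt_i2 /=; congr (v _ _); apply: val_inj.
Qed.

Lemma col2B (R : realType) (a b c d : R) :
  col2 a b - col2 c d = col2 (a - c) (b - d).
Proof. by apply/colP => i; rewrite !mxE; case: ifP. Qed.

Section TwoColumns.

Variables (R : realType) (n : nat) (X : 'M[R]_(n, 2)) (rho : R).
Hypotheses (hX1 : l2norm (col 0 X) = 1) (hX2 : l2norm (col 1 X) = 1).
Hypothesis hX12 : (col 0 X)^T *m col 1 X = (- rho)%:M.

Lemma gram_col2 (u v : R) :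
  X^T *m X *m col2 u v = col2 (u - rho * v) (v - rho * u).
Proof.
have gramE i j : (X^T *m X) i j = ((col i X)^T *m col j X) 0 0.
  by rewrite !mxE; apply: eq_bigr => k _; rewrite !mxE.
have g00 : (X^T *m X) 0 0 = 1 by rewrite gramE -l2norm_sqrE hX1 expr1n.
have g11 : (X^T *m X) 1 1 = 1 by rewrite gramE -l2norm_sqrE hX2 expr1n.
have g01 : (X^T *m X) 0 1 = - rho by rewrite gramE hX12 mxE.
have g10 : (X^T *m X) 1 0 = - rho.
  by rewrite -g01 !mxE; apply: eq_bigr => k _; rewrite !mxE mulrC.
rewrite [LHS]col2_eta; congr col2; rewrite mxE big_ord_recl big_ord1.
  by rewrite g00 (_ : lift _ _ = 1) ?g01 ?mxE//=; [ring|exact/val_inj].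
by rewrite g10 (_ : lift _ _ = 1) ?g11 ?mxE//=; [ring|exact/val_inj].
Qed.

Lemma l2norm_mul_col2 (u v : R) :
  l2norm (X *m col2 u v) ^+ 2 = u ^+ 2 + v ^+ 2 - 2 * rho * u * v.
Proof.
rewrite l2norm_sqrE trmx_mul -mulmxA [X^T *m _]mulmxA gram_col2.
rewrite mxE big_ord_recl big_ord1 !mxE /=.
by ring.
Qed.

Lemma mul_col2_inj (h : 'cV[R]_2) : 0 < rho < 1 -> X *m h = 0 -> h = 0.
Proof.
move=> /andP[rho_gt0 rho_lt1] Xh0.
have := gram_col2 (h 0 0) (h 1 0); rewrite -col2_eta -mulmxA Xh0 mulmx0.
move=> /colP e; have := e 0; have := e 1; rewrite !mxE /= => e1 e0.
have h0E : h 0 0 = rho * h 1 0 by lra.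
have h1 : h 1 0 = 0.
  (* The factor [1 - rho ^+ 2] is the Gram determinant, left after eliminating [h 0 0]. *)
  have /eqP : h 1 0 * (1 - rho ^+ 2) = 0 by rewrite [RHS]e1 h0E; ring.
  by rewrite mulf_eq0 => /orP[/eqP//|/eqP]; nra.
have h0 : h 0 0 = 0 by rewrite h0E h1 mulr0.
by rewrite [h]col2_eta h0 h1; apply/colP => i; rewrite !mxE; case: ifP.
Qed.

Lemma lasso_kkt_col2 (lambda a b c d z1 z2 : R) :
  a - c - rho * (b - d) = - lambda * z1 ->
  b - d - rho * (a - c) = - lambda * z2 ->
  `|z1| <= 1 -> `|z2| <= 1 -> z1 * a = `|a| -> z2 * b = `|b| ->
  lasso_kkt X (col2 c d) lambda (col2 a b) (col2 z1 z2).
Proof.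
move=> e1 e2 z1_le z2_le s1 s2; split=> [|i|i]; rewrite ?mxE.
- rewrite col2B gram_col2 e1 e2.
  by apply/colP => i; rewrite !mxE; case: ifP.
- by case: ifP.
- by case: ifP.
Qed.

End TwoColumns.

Unset Implicit Arguments.

Theorem lemma6p2 (R : realType) (n : nat) (X : 'M[R]_(n, 2))
    (rho phi2 lambda b1 b2 : R)
    (hX1 : l2norm (col 0 X) = 1) (hX2 : l2norm (col 1 X) = 1)
    (hX12 : (col 0 X)^T *m col 1 X = (- rho)%:M)
    (hrho : 0 < rho < 1) (hphi2 : phi2 = 1 - rho)
    (hb12 : b2 <= b1) (hb2 : 0 < b2) (hlambda : 0 < lambda) :
  let beta0 := col2 b1 b2 in
  let case1 := lambda / phi2 <= b2 in
  let case2 := b2 <= lambda / phi2 <= b2 + (b1 - b2) / phi2 in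
  let case3 := lambda / phi2 >= b2 + (b1 - b2) / phi2 in
  (exists! beta_star : 'cV[R]_2, is_noiseless_lasso X beta0 lambda beta_star) /\
  (forall beta_star : 'cV[R]_2, is_noiseless_lasso X beta0 lambda beta_star ->
    let err := l2norm (X *m (beta_star - beta0)) ^+ 2 in
    [/\ case1 -> err = 2 * lambda ^+ 2 / phi2,
        case2 -> err = phi2 * (2 - phi2) * b2 ^+ 2 + lambda ^+ 2
      & case3 -> err = l2norm (X *m beta0) ^+ 2] /\
    [/\ case1 -> beta_star = col2 (b1 - lambda / phi2) (b2 - lambda / phi2),
        case2 -> beta_star = col2 (b1 - (1 - phi2) * b2 - lambda) 0
      & case3 -> beta_star = col2 0 0]).
Proof.
move=> beta0 case1 case2 case3.
have /andP[rho_gt0 rho_lt1] := hrho.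
have phi2_gt0 : 0 < phi2 by lra.
(* Each case now only has to supply a point, a subgradient and the six scalar KKT conditions. *)
have kkt_unique a b z1 z2 e1 e2 z1_le z2_le s1 s2 :=
  @lasso_kkt_unique _ _ _ X _ _ _ _ (fun h => @mul_col2_inj _ _ _ _ hX1 hX2 hX12 h hrho)
  (ltW hlambda)
  (@lasso_kkt_col2 _ _ _ _ hX1 hX2 hX12 lambda a b b1 b2 z1 z2 e1 e2 z1_le z2_le s1 s2).
have unique1 : case1 -> unique (is_noiseless_lasso X beta0 lambda)
    (col2 (b1 - lambda / phi2) (b2 - lambda / phi2)).
  rewrite /case1 => c1.
  have e : lambda / phi2 * phi2 = lambda by rewrite divfK// gt_eqF.
  (* The vector (1, 1) is an eigenvector of the Gram matrix with eigenvalue [1 - rho = phi2], hence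
     the common shift [lambda / phi2]. *)
  apply: (kkt_unique _ _ 1 1); rewrite ?normr1 ?mul1r//.
  - by rewrite hphi2 in e *; lra.
  - by rewrite hphi2 in e *; lra.
  - by rewrite ger0_norm//; lra.
  - by rewrite ger0_norm//; lra.
have unique2 : case2 -> unique (is_noiseless_lasso X beta0 lambda)
    (col2 (b1 - (1 - phi2) * b2 - lambda) 0).
  move=> /andP[]; rewrite ler_pdivlMr// => c2l.
  rewrite -(ler_pM2r phi2_gt0) mulrDl !divfK ?gt_eqF// => c2r.
  (* The second stationarity equation, solved at a zero second coordinate, gives this [z2]. After
     dividing by [1 + rho], [z2 <= 1] is the left bound [c2l]; the right bound [c2r] makes the first
     coordinate nonnegative. *)
  apply: (kkt_unique _ _ 1 ((b2 * (1 - rho ^+ 2) - rho * lambda) / lambda)).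
  - by rewrite hphi2; ring.
  - by rewrite hphi2; field; rewrite gt_eqF.
  - by rewrite normr1.
  - rewrite ler_norml ler_pdivlMr// ler_pdivrMr//.
    by rewrite hphi2 in c2l; apply/andP; split; nra.
  - by rewrite mul1r ger0_norm// ; rewrite hphi2 in c2r *; lra.
  - by rewrite mulr0 normr0.
have unique3 : case3 -> unique (is_noiseless_lasso X beta0 lambda) (col2 0 0).
  rewrite /case3 -(ler_pM2r phi2_gt0) mulrDl !divfK ?gt_eqF// => c3.
  rewrite hphi2 in c3.
  (* At the origin [z] must be the Gram matrix applied to [beta0], divided by [lambda]. Here [c3]
     says [b1 - rho * b2 <= lambda], and [b2 <= b1] makes this the larger of the two numerators. *)
  apply: (kkt_unique _ _ ((b1 - rho * b2) / lambda) ((b2 - rho * b1) / lambda)).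
  - by field; rewrite gt_eqF.
  - by field; rewrite gt_eqF.
  - rewrite ler_norml ler_pdivlMr// ler_pdivrMr//.
    by apply/andP; split; nra.
  - rewrite ler_norml ler_pdivlMr// ler_pdivrMr//.
    by apply/andP; split; nra.
  - by rewrite mulr0 normr0.
  - by rewrite mulr0 normr0.
split.
  have [c1|/ltW c1] := lerP (lambda / phi2) b2; first by eexists; exact: unique1 c1.
  have [c2|/ltW c2] := lerP (lambda / phi2) (b2 + (b1 - b2) / phi2).
    by eexists; apply: unique2; apply/andP; split.
  by eexists; exact: unique3 c2.
move=> beta_star beta_min err.
(* Any minimizer equals the KKT point of every case that holds, so the shared boundaries of the
   cases need no separate treatment. *)
have beta1 c := esym ((unique1 c).2 _ beta_min).
have beta2 c := esym ((unique2 c).2 _ beta_min).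
have beta3 c := esym ((unique3 c).2 _ beta_min).
split; split=> // c; rewrite /err ?(beta1 c) ?(beta2 c) ?(beta3 c) col2B.
- rewrite (@l2norm_mul_col2 _ _ _ _ hX1 hX2 hX12) hphi2.
  by field; rewrite -hphi2 gt_eqF.
- by rewrite (@l2norm_mul_col2 _ _ _ _ hX1 hX2 hX12) hphi2; ring.
- by rewrite !(@l2norm_mul_col2 _ _ _ _ hX1 hX2 hX12); ring.
Qed.
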